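(* Let $F\colon\mathbf{Set}\to\mathbf{Set}$ be a functor with evaluation function $ev_F$. If $F$ preserves weak pullbacks and $ev_F$ is well-behaved, then for every pseudometric space $(X,d)$ the Wasserstein distance $W^F_d$ is a pseudometric on $FX$.
   Context: Fix $\top\in(0,\infty]$; a pseudometric on $X$ is $d\colon X\times X\to[0,\top]$ that is reflexive, symmetric and satisfies the triangle inequality (with $a+\infty=\infty$). $d_e$ is the Euclidean distance on $[0,\top]$ (with $d_e(a,\infty)=\infty$ for $a\ne\infty$, $d_e(\infty,\infty)=0$). An evaluation function for $F$ is any $ev_F\colon F[0,\top]\to[0,\top]$; for $g\colon X\to[0,\top]$ put $\tilde Fg=ev_F\circ Fg$. $ev_F$ is well-behaved if (W1) $f\le g$ (pointwise) implies $\tilde Ff\le\tilde Fg$; (W2) for every $t\in F([0,\top]^2)$, $d_e(ev_F(F\pi_1 t),ev_F(F\pi_2 t))\le\tilde F d_e(t)$, where $\pi_i$ are the projections; (W3) $ev_F^{-1}[\{0\}]=Fi[F\{0\}]$ where $i\colon\{0\}\hookrightarrow[0,\top]$ is the inclusion. A coupling of $t_1,t_2\in FX$ is $t\in F(X\times X)$ with $F\pi_i(t)=t_i$ for $i=1,2$. The Wasserstein distance is $W^F_d(t_1,t_2)=\inf\{\tilde Fd(t)\mid t\text{ a coupling of }t_1,t_2\}$, with $\inf\emptyset=\top$. *)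

(* Defs.v *)
From mathcomp Require Import all_boot all_order all_algebra.
From mathcomp Require Import all_classical all_reals ereal.

Set Implicit Arguments.
Unset Strict Implicit.
Unset Printing Implicit Defensive.

Import Order.TTheory GRing.Theory Num.Theory.
Local Open Scope classical_set_scope.
Local Open Scope ring_scope.
Local Open Scope ereal_scope.

(* A fixed universe, so that endofunctors of [Sets] are endofunctors of one
   category and not maps between types of two unrelated sizes. *)
Definition Sets := Type.

Record set_functor := SetFunctor {
  fobj :> Sets -> Sets;
  fmor : forall X Y : Sets, (X -> Y) -> fobj X -> fobj Y;
  fmor_id : forall X : Sets, fmor (@id X) = @id (fobj X);
  fmor_comp : forall (X Y Z : Sets) (g : Y -> Z) (f : X -> Y),
    fmor (g \o f) = fmor g \o fmor f }.

Arguments fmor F {X Y} f t : rename.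

Definition weak_pullback (P A B C : Sets)
    (p : P -> A) (q : P -> B) (f : A -> C) (g : B -> C) : Prop :=
  f \o p = g \o q /\
  forall (Z : Sets) (a : Z -> A) (b : Z -> B), f \o a = g \o b ->
    exists h : Z -> P, p \o h = a /\ q \o h = b.

Definition preserves_weak_pullbacks (F : set_functor) : Prop :=
  forall (P A B C : Sets)
    (p : P -> A) (q : P -> B) (f : A -> C) (g : B -> C),
  weak_pullback p q f g ->
  weak_pullback (fmor F p) (fmor F q) (fmor F f) (fmor F g).

Definition itv0 (R : realType) (top : \bar R) : Sets :=
  {x : \bar R | 0 <= x <= top}.

Coercion itv0_val (R : realType) (top : \bar R) (x : itv0 top) : \bar R :=
  sval x.

(* The case [a = b] is separate because [+oo - +oo] is [-oo] in [\bar R],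
   whereas the distance from [+oo] to itself is [0]. *)
Definition edistance (R : realType) (a b : \bar R) : \bar R :=
  if a == b then 0 else `|a - b|.

Lemma edistance_itv (R : realType) (top : \bar R) (a b : itv0 top) :
  0 <= edistance a b <= top.
Proof.
rewrite /edistance.
case: a => a /= /andP[a0 at_]; case: b => b /= /andP[b0 bt].
case: (eqVneq a b) => [_|ab]; first by rewrite lexx (le_trans a0 at_).
rewrite abse_ge0 /=.
suff h : `|a - b| <= maxe a b by rewrite (le_trans h)// ge_max at_ bt.
move: a b a0 b0 ab {at_ bt} => [a| |] [b| |] //= a0 b0 _.
- rewrite -EFin_max lee_fin le_max; rewrite !lee_fin in a0 b0.
  by case: (lerP b a) => h; rewrite gerBl ?a0 ?b0 ?orbT.
- by rewrite le_max leey orbT.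
Qed.

Definition d_e (R : realType) (top : \bar R) (ab : itv0 top * itv0 top) :
    itv0 top :=
  exist _ (edistance ab.1 ab.2) (edistance_itv ab.1 ab.2).

Definition pseudometric (R : realType) (top : \bar R) (X : Sets)
    (d : X * X -> itv0 top) : Prop :=
  [/\ forall x, d (x, x) = 0 :> \bar R,
      forall x y, d (x, y) = d (y, x) &
      forall x y z, (d (x, z) : \bar R) <= d (x, y) + d (y, z)].

Definition ev_lift (R : realType) (top : \bar R) (F : set_functor)
    (ev : F (itv0 top) -> itv0 top) (X : Sets) (g : X -> itv0 top) :
    F X -> itv0 top :=
  ev \o fmor F g.

Definition zero_part (R : realType) (top : \bar R) : Sets :=
  {x : itv0 top | x = 0 :> \bar R}.

Definition zero_incl (R : realType) (top : \bar R) (x : zero_part top) :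
    itv0 top :=
  sval x.

Record well_behaved (R : realType) (top : \bar R) (F : set_functor)
    (ev : F (itv0 top) -> itv0 top) : Prop := WellBehaved {
  ev_mono : forall (X : Sets) (f g : X -> itv0 top),
    (forall x, (f x : \bar R) <= g x) ->
    forall t : F X, (ev_lift ev f t : \bar R) <= ev_lift ev g t;
  ev_dist : forall t : F (itv0 top * itv0 top)%type,
    (d_e (ev (fmor F fst t), ev (fmor F snd t)) : \bar R)
      <= ev_lift ev (@d_e R top) t;
  ev_zero : ev @^-1` [set r | r = 0 :> \bar R] =
    range (fmor F (@zero_incl R top)) }.

Definition coupling (F : set_functor) (X : Sets) (t1 t2 : F X) :
    set (F (X * X)%type) :=
  [set t | fmor F fst t = t1 /\ fmor F snd t = t2].

Lemma itv0_inf_subproof (R : realType) (top : \bar R) (top_gt0 : 0 < top)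
    (A : set (itv0 top)) :
  0 <= mine top (ereal_inf [set (x : \bar R) | x in A]) <= top.
Proof.
rewrite ge_min lexx andbT le_min (ltW top_gt0) /=.
by apply: le_ereal_inf_tmp => _ [[x /= /andP[x0 _]] _ <-].
Qed.

(* The infimum of [A] in the complete lattice [0, top]; the [mine top] only
   matters when [A] is empty, where [ereal_inf] is [+oo] and not [top]. *)
Definition itv0_inf (R : realType) (top : \bar R) (top_gt0 : 0 < top)
    (A : set (itv0 top)) : itv0 top :=
  exist _ (mine top (ereal_inf [set (x : \bar R) | x in A]))
    (itv0_inf_subproof top_gt0 A).

Definition wasserstein (R : realType) (top : \bar R) (top_gt0 : 0 < top)
    (F : set_functor) (ev : F (itv0 top) -> itv0 top) (X : Sets)
    (d : X * X -> itv0 top) (t : F X * F X) : itv0 top :=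
  itv0_inf top_gt0 [set ev_lift ev d s | s in coupling t.1 t.2].

(* Main.v *)
(* Couplings [s12] of [t1, t2] and [s23] of [t2, t3] glue to an element of
   [F (X * X * X)], because [X * X * X] is the pullback of the projections of
   [X * X] to the shared coordinate and [F] weakly preserves it. Writing [dij]
   for the distance of coordinates [i] and [j], the reverse triangle inequality
   [|d13 - d12| <= d23] together with (W2) and (W1) bounds the lifted [d13] by
   the sum of the lifted [d12] and [d23]. The diagonal coupling and (W3) give
   reflexivity, swapping the coordinates of couplings gives symmetry. *)
Require Import Defs.
From mathcomp Require Import all_boot all_order all_algebra.
From mathcomp Require Import all_classical all_reals ereal.

Set Implicit Arguments.
Unset Strict Implicit.
Unset Printing Implicit Defensive.

Import Order.TTheory GRing.Theory Num.Theory.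
Local Open Scope classical_set_scope.
Local Open Scope ereal_scope.

Lemma itv0_ge0 (R : realType) (top : \bar R) (x : itv0 top) :
  0 <= (x : \bar R).
Proof. by case: x => x /= /andP[]. Qed.

Lemma itv0_le_top (R : realType) (top : \bar R) (x : itv0 top) :
  (x : \bar R) <= top.
Proof. by case: x => x /= /andP[]. Qed.

Lemma fmorE (F : set_functor) (X Y Z : Sets) (g : Y -> Z) (f : X -> Y)
    (t : F X) : fmor F g (fmor F f t) = fmor F (g \o f) t.
Proof. by rewrite fmor_comp. Qed.

(** The two sum inequalities express [|a - b| <= c] without a difference, so they stay meaningful at
    [+oo]: if exactly one of [a], [b] is infinite, they force [c] to be [+oo]. *)
Lemma le_edistance (R : realType) (a b c : \bar R) :
  0 <= a -> 0 <= b -> 0 <= c ->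
  a <= b + c -> b <= a + c -> edistance a b <= c.
Proof.
rewrite /edistance; case: eqVneq => // ab.
move: a b c ab => [a| |] [b| |] [c| |] //=; rewrite ?leey//.
rewrite !lee_fin => _ _ _ _ ab ba.
by rewrite ler_norml lerBlDl ab lerBrDl lerBlDr ba.
Qed.

Lemma le_addr_edistance (R : realType) (a b : \bar R) :
  0 <= a -> 0 <= b -> a <= b + edistance a b.
Proof.
rewrite /edistance; case: eqVneq => [-> _ _|_]; first by rewrite adde0.
move: a b => [a| |] [b| |] //=; rewrite ?leey// !lee_fin => _ _.
by rewrite -lerBlDl ler_norm.
Qed.

(** Finite infima are approached within [e / 2] by members of [A] and [B]. By nonnegativity an
    infimum that is not finite is [+oo], and then so is the sum. *)
Lemma le_add_ereal_inf (R : realType) (A B : set (\bar R)) (c : \bar R) :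
  (forall a, A a -> 0 <= a) -> (forall b, B b -> 0 <= b) ->
  (forall a b, A a -> B b -> c <= a + b) ->
  c <= ereal_inf A + ereal_inf B.
Proof.
move=> A0 B0 cAB.
have iA0 : 0 <= ereal_inf A by apply: le_ereal_inf_tmp.
have iB0 : 0 <= ereal_inf B by apply: le_ereal_inf_tmp.
have [Afin|] := boolP (ereal_inf A \is a fin_num); last first.
  by rewrite ge0_fin_numE// ltey negbK => /eqP ->; rewrite addye ?leey// gt_eqF// (lt_le_trans _ iB0).
have [Bfin|] := boolP (ereal_inf B \is a fin_num); last first.
  by rewrite ge0_fin_numE// ltey negbK => /eqP ->; rewrite addey ?leey// gt_eqF// (lt_le_trans _ iA0).
apply/lee_addgt0Pr => e e0.
have e20 : (0 < e / 2)%R by rewrite divr_gt0.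
have [a Aa /ltW ae] := lb_ereal_inf_adherent e20 Afin.
have [b Bb /ltW be] := lb_ereal_inf_adherent e20 Bfin.
apply: (le_trans (cAB _ _ Aa Bb)); apply: (le_trans (leeD ae be)).
by rewrite addeACA -EFinD -splitr.
Qed.

Lemma itv0_inf_le (R : realType) (top : \bar R) (top_gt0 : 0 < top)
    (A : set (itv0 top)) (a : itv0 top) :
  A a -> (itv0_inf top_gt0 A : \bar R) <= a.
Proof.
by move=> Aa; rewrite /= ge_min; apply/orP; right; apply: ereal_inf_lbound; exists a.
Qed.

Lemma le_add_itv0_inf (R : realType) (top : \bar R) (top_gt0 : 0 < top)
    (A B : set (itv0 top)) (c : itv0 top) :
  (forall a b, A a -> B b -> (c : \bar R) <= (a : \bar R) + b) ->
  (c : \bar R) <= (itv0_inf top_gt0 A : \bar R) + itv0_inf top_gt0 B.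
Proof.
move=> cAB.
have vA := itv0_ge0 (itv0_inf top_gt0 A).
have vB := itv0_ge0 (itv0_inf top_gt0 B).
move: vA vB => /=.
(* If either minimum is [top], as for an empty set, the sum is at least [top] and hence at least
   [c]; only two genuine infima remain. *)
case: (leP top (ereal_inf _)) => _ vA; case: (leP top (ereal_inf _)) => _ vB;
  try by apply: (le_trans (itv0_le_top c)); rewrite ?leeDl ?leeDr.
apply: le_add_ereal_inf.
- by move=> _ [a _ <-]; apply: itv0_ge0.
- by move=> _ [b _ <-]; apply: itv0_ge0.
- by move=> _ _ [a Aa <-] [b Bb <-]; apply: cAB.
Qed.

Lemma weak_pullback_snd_fst (X Y Z : Sets) :
  @weak_pullback (X * Y * Z)%type (X * Y)%type (Y * Z)%type Y
    fst (fun u => (u.1.2, u.2)) snd fst.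
Proof.
split=> // T a b ab; exists (fun z => (a z, (b z).2)); split=> //.
apply: funext => z /=; have /= -> := congr1 (@^~ z) ab.
by case: (b z).
Qed.

Lemma glue_couplings (F : set_functor) (F_wp : preserves_weak_pullbacks F)
    (X Y Z : Sets) (s : F (X * Y)%type) (t : F (Y * Z)%type) :
  fmor F snd s = fmor F fst t ->
  exists u : F (X * Y * Z)%type,
    fmor F fst u = s /\ fmor F (fun u => (u.1.2, u.2)) u = t.
Proof.
move=> st.
have [_ lift] := F_wp _ _ _ _ _ _ _ _ (@weak_pullback_snd_fst X Y Z).
(* Elements are maps out of [unit], so the lifting property yields the glued element. *)
have [|h [hs ht]] := lift unit (fun=> s) (fun=> t).
  by apply: funext => -[] /=.
by exists (h tt); split; [apply: (congr1 (@^~ tt) hs)|apply: (congr1 (@^~ tt) ht)].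
Qed.

Section WellBehaved.
Variables (R : realType) (top : \bar R) (F : set_functor).
Variables (ev : F (itv0 top) -> itv0 top) (ev_wb : well_behaved ev).

Lemma ev_lift_fmor (X Y : Sets) (g : Y -> itv0 top) (f : X -> Y) (t : F X) :
  ev_lift ev g (fmor F f t) = ev_lift ev (g \o f) t.
Proof. by rewrite /ev_lift /= fmorE. Qed.

Lemma ev_lift_eq0 (X : Sets) (g : X -> itv0 top) (t : F X) :
  (forall x, g x = 0 :> \bar R) -> ev_lift ev g t = 0 :> \bar R.
Proof.
(* [g] factors through the inclusion of zero as [k], so (W3) applies to [fmor F g t]. *)
move=> g0; pose k x : zero_part top := exist _ (g x) (g0 x).
have : range (fmor F (@zero_incl R top)) (fmor F g t).
  by exists (fmor F k t) => //; rewrite fmorE.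
by rewrite -(ev_zero ev_wb).
Qed.

Lemma ev_lift_le_add (X : Sets) (f g h : X -> itv0 top) (t : F X) :
  (forall x, (f x : \bar R) <= (g x : \bar R) + h x) ->
  (forall x, (g x : \bar R) <= (f x : \bar R) + h x) ->
  (ev_lift ev f t : \bar R) <= (ev_lift ev g t : \bar R) + ev_lift ev h t.
Proof.
move=> fgh gfh.
apply: le_trans (le_addr_edistance _ _) _.
- exact: itv0_ge0.
- exact: (itv0_ge0 (ev_lift ev g t)).
apply: leeD => //.
(* Pushing [t] along the pairing of [f] and [g] turns (W2) into a bound by the lift of the pointwise
   distance, which (W1) compares with [h]. *)
have := ev_dist ev_wb (fmor F (fun x => (f x, g x)) t).
rewrite ev_lift_fmor !fmorE => /le_trans; apply.
apply: (ev_mono ev_wb) => x /=.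
by apply: le_edistance => //; apply: itv0_ge0.
Qed.

End WellBehaved.

Theorem theorem5p20 (R : realType) (top : \bar R) (top_gt0 : 0 < top)
    (F : set_functor) (ev : F (itv0 top) -> itv0 top)
    (F_wp : preserves_weak_pullbacks F) (ev_wb : well_behaved ev)
    (X : Sets) (d : X * X -> itv0 top) (d_pm : pseudometric d) :
  pseudometric (wasserstein top_gt0 ev d).
Proof.
have [d0 dC dT] := d_pm; split.
- move=> t; apply/eqP; rewrite eq_le itv0_ge0 andbT.
  pose s := fmor F (fun x => (x, x)) t.
  have s_cpl : coupling t t s by split; rewrite fmorE; apply: (congr1 (@^~ t) (fmor_id F X)).
  have s0 : ev_lift ev d s = 0 :> \bar R by rewrite ev_lift_fmor; apply: ev_lift_eq0.
  by rewrite -s0; apply: (itv0_inf_le top_gt0); exists s.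
- move=> t1 t2; congr itv0_inf.
  pose swap (x : X * X) := (x.2, x.1).
  have d_swap : d \o swap = d by apply: funext => -[x y] /=; rewrite dC.
  (* Swapping exchanges the marginals and keeps the lifted value, so the same witness serves both
     inclusions. *)
  by apply/seteqP; split=> _ [s [s1 s2] <-]; exists (fmor F swap s);
    rewrite ?ev_lift_fmor ?d_swap//; split; rewrite fmorE.
- move=> t1 t2 t3; apply: le_add_itv0_inf => _ _ [s12 /= [s1 s2] <-] [s23 /= [s2' s3] <-].
  have [|u [us12 us23]] := @glue_couplings F F_wp _ _ _ s12 s23.
    by rewrite s2 s2'.
  pose p13 (x : X * X * X) := (x.1.1, x.2).
  apply: (@le_trans _ _ (ev_lift ev d (fmor F p13 u) : \bar R)).
    apply: (itv0_inf_le top_gt0); exists (fmor F p13 u) => //; split.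
      by rewrite /= fmorE -s1 -us12 fmorE.
    by rewrite /= fmorE -s3 -us23 fmorE.
  rewrite -us12 -us23 !ev_lift_fmor.
  (* The second condition, [d (x, y) <= d (x, z) + d (y, z)], is the triangle inequality through
     [z], up to symmetry. *)
  apply: ev_lift_le_add => // -[[x y] z] /=; first exact: dT.
  by rewrite (dC y z); apply: dT.
Qed.
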